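(* For every $w\in\mathbb N$, the set $\mathcal{AT}_w$ of all ACMPL's $\mathrm{Li}\begin{pmatrix}\varepsilon_1&\dots&\varepsilon_n\\ s_1&\dots&s_n\end{pmatrix}$ of weight $w$ such that $s_1,\dots,s_{n-1}\le q$ and $s_n<q$ is a set of generators of the $K$-vector space $\mathcal{AL}_w$.
   Context: Let $\mathbb F_q$ be a finite field with $q$ elements, $K=\mathbb F_q(\theta)$, $K_\infty=\mathbb F_q((1/\theta))$, $\mathbb N=\{1,2,\dots\}$. Put $\ell_0=1$ and $\ell_d=\prod_{i=1}^d(\theta-\theta^{q^i})$ for $d\ge1$. For $\mathfrak s=(s_1,\dots,s_n)\in\mathbb N^n$ and $\varepsilon=(\varepsilon_1,\dots,\varepsilon_n)\in(\mathbb F_q^\times)^n$ the alternating Carlitz multiple polylogarithm (ACMPL) is $$\mathrm{Li}\begin{pmatrix}\varepsilon\\ \mathfrak s\end{pmatrix}=\sum_{d_1>\dots>d_n\ge0}\frac{\varepsilon_1^{d_1}\cdots\varepsilon_n^{d_n}}{\ell_{d_1}^{s_1}\cdots\ell_{d_n}^{s_n}}\in K_\infty,$$ of weight $s_1+\dots+s_n$. $\mathcal{AL}_w$ is the $K$-vector subspace of $K_\infty$ spanned by all ACMPL's of weight $w$. *)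

(* Defs.v *)
From HB Require Import structures.
From mathcomp Require Import all_boot all_order all_algebra.
From mathcomp Require Import boolp classical_sets functions fsbigop filter.
From mathcomp Require Import topology zify.

Set Implicit Arguments.
Unset Strict Implicit.
Unset Printing Implicit Defensive.

Import Order.TTheory GRing.Theory Num.Theory.

Local Open Scope classical_set_scope.
Local Open Scope ring_scope.

(* [laurent F] is F((1/theta)): the series x stands for
   \sum_n (x n) theta^(-n), with only finitely many negative indices. *)
Record laurent (F : fieldType) := Laurent {
  lcoef :> int -> F;
  _ : exists N : int, forall n : int, n < N -> lcoef n = 0
}.

Section LaurentField.
Variable F : fieldType.
Implicit Types x y z : laurent F.

HB.instance Definition _ := gen_eqMixin (laurent F).
HB.instance Definition _ := gen_choiceMixin (laurent F).

Lemma laurentP x y : (forall n, x n = y n) -> x = y.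
Proof.
case: x y => [f fP] [g gP] /= fg; have {}fg : f = g by apply/funext.
by case: _ / fg gP => gP; congr Laurent; exact: Prop_irrelevance.
Qed.

Lemma laurent_bounded x : exists N : int, forall n : int, n < N -> x n = 0.
Proof. by case: x. Qed.

Fact lzero_subproof :
  exists N : int, forall n : int, n < N -> (fun _ : int => 0 : F) n = 0.
Proof. by exists 0. Qed.
Definition lzero := Laurent lzero_subproof.

Fact lopp_subproof x : exists N : int, forall n : int, n < N -> - x n = 0.
Proof.
by have [N xN] := laurent_bounded x; exists N => n /xN ->; rewrite oppr0.
Qed.
Definition lopp x := Laurent (lopp_subproof x).

Fact ladd_subproof x y : exists N : int, forall n : int, n < N -> x n + y n = 0.
Proof.
have [[N xN] [M yM]] := (laurent_bounded x, laurent_bounded y).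
exists (Num.min N M) => n; rewrite lt_min => /andP[/xN -> /yM ->].
by rewrite addr0.
Qed.
Definition ladd x y := Laurent (ladd_subproof x y).

Fact laddA : associative ladd.
Proof. by move=> x y z; apply: laurentP => n /=; rewrite addrA. Qed.
Fact laddC : commutative ladd.
Proof. by move=> x y; apply: laurentP => n /=; rewrite addrC. Qed.
Fact ladd0 : left_id lzero ladd.
Proof. by move=> x; apply: laurentP => n /=; rewrite add0r. Qed.
Fact laddN : left_inverse lzero lopp ladd.
Proof. by move=> x; apply: laurentP => n /=; rewrite addNr. Qed.
HB.instance Definition _ :=
  GRing.isZmodule.Build (laurent F) laddA laddC ladd0 laddN.

(* The sum is over all integers i; it has finite support. *)
Definition lconv (f g : int -> F) (n : int) : F :=
  \sum_(i \in [set: int]) f i * g (n - i).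

Lemma lconvE (s : int) (m : nat) (f g : int -> F) (n : int) :
    (forall i, i < s -> f i = 0) ->
    (forall i, i <= n - s - m%:Z -> g i = 0) ->
  lconv f g n = \sum_(k < m) f (s + k%:Z) * g (n - s - k%:Z).
Proof.
move=> fs gm; pose r := [seq s + k%:Z | k <- index_iota 0 m].
rewrite /lconv -(fsbig_widen [set` r]) //; last first.
  move=> i [_ /negP/= ir]; have [/fs ->|si] := ltP i s; first by rewrite mul0r.
  rewrite gm ?mulr0//; rewrite leNgt; apply: contra ir => lti.
  apply/mapP; exists (absz (i - s)%R); last by lia.
  by rewrite mem_index_iota; lia.
rewrite -fsbig_seq; last by rewrite map_inj_uniq ?iota_uniq// => a b; lia.
rewrite big_map big_mkord; apply: eq_bigr => k _; congr (_ * g _); lia.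
Qed.

Fact lmul_subproof x y : exists N : int, forall n : int, n < N -> lconv x y n = 0.
Proof.
have [[N xN] [M yM]] := (laurent_bounded x, laurent_bounded y).
exists (N + M) => n ltn; rewrite (@lconvE N 0) ?big_ord0// => i ltin.
by apply: yM; lia.
Qed.
Definition lmul x y := Laurent (lmul_subproof x y).

Fact lmulC : commutative lmul.
Proof.
move=> x y; apply: laurentP => n /=.
have [[N xN] [M yM]] := (laurent_bounded x, laurent_bounded y).
pose m := absz (n - N - M + 1)%R.
rewrite (@lconvE N m.+1) => // [|i lei]; last by apply: yM; lia.
rewrite (@lconvE (n - N - m%:Z) m.+1) => [|i lti|i lti]; first last.
- by apply: xN; lia.
- by apply: yM; lia.
rewrite (reindex_inj rev_ord_inj) /=; apply: eq_bigr => k _; have := ltn_ord k.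
by move=> ltk; rewrite mulrC; congr (y _ * x _); lia.
Qed.

Fact lmulA : associative lmul.
Proof.
move=> x y z; apply: laurentP => n /=.
have [[[N xN] [M yM]] [P zP]] :=
  (laurent_bounded x, laurent_bounded y, laurent_bounded z).
pose m := absz (n - N - M - P + 1)%R.
have yz0 i : i < M + P -> lmul y z i = 0.
  move=> lti /=; rewrite (@lconvE M 0) ?big_ord0// => j lej.
  by apply: zP; lia.
have xy0 i : i < N + M -> lmul x y i = 0.
  move=> lti /=; rewrite (@lconvE N 0) ?big_ord0// => j lej.
  by apply: yM; lia.
rewrite (@lconvE N m) => // [|i lei]; last by apply: yz0; lia.
rewrite (@lconvE (N + M) m) => // [|i lei]; last by apply: zP; lia.
under eq_bigr => i _.
  rewrite /= (@lconvE (M - i%:Z) m); first last.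
  - by move=> j ltj; apply: zP; lia.
  - by move=> j ltj; apply: yM; lia.
  rewrite big_distrr /=; over.
under [RHS]eq_bigr => k _.
  rewrite /= (@lconvE N m); first last.
  - by move=> j ltj; apply: yM; move: (ltn_ord k); lia.
  - by move=> j ltj; apply: xN; lia.
  rewrite big_distrl /=; over.
rewrite exchange_big /=; apply: eq_bigr => k _; apply: eq_bigr => i _.
by rewrite mulrA; congr (_ * y _ * z _); lia.
Qed.

Lemma lmono_subproof (c : F) (k : int) :
  exists N : int, forall n : int, n < N -> (if n == k then c else 0) = 0.
Proof. by exists k => n ltnk; rewrite ifF//; apply: lt_eqF. Qed.
(* The monomial c theta^(-k). *)
Definition lmono c k := Laurent (lmono_subproof c k).

Lemma lmul_monoE c k x n : lmul (lmono c k) x n = c * x (n - k).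
Proof.
have [N xN] := laurent_bounded x; pose m := absz (n - N - k + 1)%R.
rewrite /= (@lconvE k m.+1) => [|i lti|i lei].
- rewrite big_ord_recl /= addr0 eqxx subr0 big1 ?addr0// => i _.
  by rewrite ifF ?mul0r//; apply/eqP; rewrite /bump /=; lia.
- by rewrite ifF//; lia.
- by apply: xN; lia.
Qed.

Fact lmul1 : left_id (lmono 1 0) lmul.
Proof. by move=> x; apply: laurentP => n; rewrite lmul_monoE mul1r subr0. Qed.

Fact lmulDl : left_distributive lmul ladd.
Proof.
move=> x y z; apply: laurentP => n /=.
have [[[N xN] [M yM]] [P zP]] :=
  (laurent_bounded x, laurent_bounded y, laurent_bounded z).
pose s := Num.min N M; pose m := absz (n - s - P + 1)%R.
have xs i : i < s -> x i = 0 by move=> lti; apply: xN; lia.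
have ys i : i < s -> y i = 0 by move=> lti; apply: yM; lia.
have zm i : i <= n - s - m%:Z -> z i = 0 by move=> lei; apply: zP; lia.
rewrite !(@lconvE s m)// => [|i lti]; last by rewrite xs ?ys ?addr0.
by rewrite -big_split; apply: eq_bigr => k _; rewrite /= mulrDl.
Qed.

Fact lone_neq0 : lmono 1 0 != 0 :> laurent F.
Proof.
apply/eqP => /(congr1 (fun x : laurent F => x 0)) /= /eqP.
by rewrite oner_eq0.
Qed.

HB.instance Definition _ := GRing.Zmodule_isComNzRing.Build (laurent F)
  lmulA lmulC lmul1 lmulDl lone_neq0.

Lemma lval_ex x : x != 0 ->
  exists v : int, x v != 0 /\ forall n, n < v -> x n = 0.
Proof.
move=> x0; have [N xN] := laurent_bounded x.
have exk : exists k : nat, x (N + k%:Z) != 0.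
  apply/not_existsP => xk; move/eqP: x0; apply; apply: laurentP => n /=.
  have [/xN //|leNn] := ltP n N; have /negP := xk (absz (n - N)%R).
  by rewrite negbK => /eqP; congr (x _ = _); lia.
case: (ex_minnP exk) => k xk mink; exists (N + k%:Z); split=> // n ltn.
have [/xN //|leNn] := ltP n N; apply/eqP; case: eqP => // /eqP xn.
by have := mink (absz (n - N)%R); rewrite (_ : N + _ = n) => [/(_ xn)|]; lia.
Qed.

Fixpoint linv_seq (a : nat -> F) (n : nat) : seq F :=
  if n isn't m.+1 then [::] else
  let b := linv_seq a m in
  rcons b ((a 0%N)^-1 * ((m == 0)%N%:R - \sum_(i < m) a (m - i)%N * b`_i)).

Lemma linv_seqP (a : nat -> F) : a 0%N != 0 ->
  exists b : nat -> F,
    forall n, \sum_(i < n.+1) a i * b (n - i)%N = (n == 0)%N%:R.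
Proof.
move=> a0; pose b n := (linv_seq a n.+1)`_n; exists b => n.
have szb m : size (linv_seq a m) = m by elim: m => //= m IH; rewrite size_rcons IH.
have bE m i : (i < m)%N -> (linv_seq a m)`_i = b i.
  elim: m => // m IH; rewrite ltnS leq_eqVlt => /predU1P[->//|ltim].
  by rewrite /= nth_rcons szb ltim IH.
rewrite big_ord_recl subn0 {1}/b /= nth_rcons szb ltnn eqxx mulVKf//.
rewrite (_ : \sum_(i < n) a (n - i)%N * _ =
             \sum_(i < n) a (bump 0 i) * b (n - bump 0 i)%N) ?subrK//.
rewrite (reindex_inj rev_ord_inj) /=; apply: eq_bigr => i _.
rewrite bE; last by move: (ltn_ord i); lia.
by congr (a _ * b _); move: (ltn_ord i); rewrite /bump /=; lia.
Qed.

Lemma linv_ex x : x != 0 -> exists y, y * x = 1.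
Proof.
move=> /lval_ex [v [xv xlt]].
have [b bP] : exists b : nat -> F,
    forall n, \sum_(i < n.+1) x (v + i%:Z) * b (n - i)%N = (n == 0)%N%:R.
  by apply: (@linv_seqP (fun k => x (v + k%:Z))); rewrite addr0.
pose g (n : int) := if n < - v then 0 else b (absz (n + v)%R).
have gP : exists N : int, forall n : int, n < N -> g n = 0.
  by exists (- v) => n ltn; rewrite /g ltn.
exists (Laurent gP); rewrite mulrC; apply: laurentP => n /=.
have [n0|n0] := ltP n 0.
  rewrite (@lconvE v 0) ?big_ord0 => // [|i lei]; first by rewrite ifF//; lia.
  by rewrite /g ifT//; lia.
rewrite (@lconvE v (absz n).+1)// => [|i lei]; last by rewrite /g ifT//; lia.
rewrite (eq_bigr (fun i : 'I_ (absz n).+1 => x (v + i%:Z) * b (absz n - i)%N)).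
  by rewrite bP; case: eqP => [|] ?; case: eqP => // ?; lia.
move=> i _; congr (_ * _); move: (ltn_ord i) => lti.
by rewrite /g ifF; [congr b|]; lia.
Qed.

Definition linv x : laurent F :=
  if pselect (exists y, y * x = 1) is left ex then projT1 (cid ex) else 0.

Fact lmulVf x : x != 0 -> linv x * x = 1.
Proof.
by move=> /linv_ex exy; rewrite /linv; case: pselect => // ex; case: cid.
Qed.

Fact linv0 : linv 0 = 0.
Proof.
rewrite /linv; case: pselect => // ex; exfalso; case: ex => y.
by rewrite mulr0 => /esym/eqP; rewrite oner_eq0.
Qed.

HB.instance Definition _ := GRing.ComNzRing_isField.Build (laurent F)
  lmulVf linv0.

End LaurentField.

(* The (1/theta)-adic uniform structure: x and y are close when they agree on
   all coefficients of index < N, i.e. |x - y| <= q^(-N). *)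
Section LaurentUniform.
Variable F : fieldType.

Definition lball (N : int) : set (laurent F * laurent F) :=
  [set xy : laurent F * laurent F | forall n : int, n < N -> xy.1 n = xy.2 n].

Definition lentourage : set_system (laurent F * laurent F) :=
  [set E | exists N : int, lball N `<=` E].

Fact lentourage_filter : Filter lentourage.
Proof.
split; first by exists 0.
- move=> A B [N NA] [M MB]; exists (Num.max N M) => xy xyE.
  split; [apply: NA|apply: MB] => n ltn; apply: xyE;
    by rewrite lt_max ltn ?orbT.
- by move=> A B AB [N NA]; exists N => xy /NA /AB.
Qed.

Fact lentourage_diagonal A : lentourage A -> diagonal `<=` A.
Proof. by move=> [N NA] xy xyE; apply: NA => n _; rewrite xyE. Qed.

Fact lentourage_inv A : lentourage A -> lentourage (A^-1)%relation.
Proof.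
by move=> [N NA]; exists N => xy xyN; apply: NA => n ltn /=; rewrite xyN.
Qed.

Fact lentourage_split A : lentourage A ->
  exists2 B, lentourage B & (B \; B `<=` A)%relation.
Proof.
move=> [N NA]; exists (lball N); first by exists N.
by move=> [x z] [y /= xy yz]; apply: NA => n ltn; rewrite /= xy ?yz.
Qed.

HB.instance Definition _ := isUniform.Build (laurent F) lentourage_filter
  lentourage_diagonal lentourage_inv lentourage_split.
HB.instance Definition _ := isPointed.Build (laurent F) 0.

Lemma laurent_nbhsP (x : laurent F) (A : set (laurent F)) :
  nbhs x A <->
  exists N : int,
    forall y : laurent F, (forall n : int, n < N -> x n = y n) -> A y.
Proof.
split=> [[E [N NE] EA]|[N NA]].
  by exists N => y xy; apply: EA; apply/mem_set/NE.
exists (lball N); first by exists N.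
by move=> y /set_mem; apply: NA.
Qed.

Lemma laurent_cvgP (u : nat -> laurent F) (x : laurent F) :
  (u @ \oo --> x) <->
  forall N : int, exists D : nat, forall k, (D <= k)%N ->
    forall n : int, n < N -> x n = u k n.
Proof.
split=> [ux N|ux A /laurent_nbhsP[N NA]].
  have /ux[D _ DP] : nbhs x [set y : laurent F | forall n : int, n < N -> x n = y n].
    by apply/laurent_nbhsP; exists N.
  by exists D.
by have [D DP] := ux N; exists D => // k /DP /NA.
Qed.

Lemma laurent_hausdorff : hausdorff_space (laurent F).
Proof.
move=> x y xy; apply: laurentP => n.
have [] := xy [set z : laurent F | x n = z n] [set z : laurent F | y n = z n].
- by apply/laurent_nbhsP; exists (n + 1) => z ->//; rewrite ltrDl.
- by apply/laurent_nbhsP; exists (n + 1) => z ->//; rewrite ltrDl.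
- by move=> z [/= -> ->].
Qed.

End LaurentUniform.

(* [ratfun F] is F(theta). *)
Notation ratfun F := {fraction {poly F}}.

Section Embedding.
Variable F : fieldType.

Definition lconst (c : F) : laurent F := lmono c 0.

Fact lconst_zmod : zmod_morphism lconst.
Proof.
by move=> a b; apply: laurentP => n /=; case: eqP => //; rewrite subr0.
Qed.
Fact lconst_monoid : monoid_morphism lconst.
Proof.
split=> // a b; apply: laurentP => n; rewrite [RHS]lmul_monoE /= subr0.
by case: eqP => //; rewrite mulr0.
Qed.
HB.instance Definition _ :=
  GRing.isZmodMorphism.Build F (laurent F) lconst lconst_zmod.
HB.instance Definition _ :=
  GRing.isMonoidMorphism.Build F (laurent F) lconst lconst_monoid.

Definition ltheta : laurent F := lmono 1 (- 1).

Definition poly_laurent : {poly F} -> laurent F :=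
  horner_morph (fun c : F => mulrC ltheta (lconst c)).
HB.instance Definition _ := GRing.RMorphism.on poly_laurent.

Lemma ltheta_exp k : ltheta ^+ k = lmono 1 (- k%:Z).
Proof.
elim: k => [|k IH]; first by rewrite expr0 oppr0.
rewrite exprS IH; apply: laurentP => n; rewrite [LHS]lmul_monoE /= mul1r.
by congr (if _ then _ else _); apply/eqP/eqP; lia.
Qed.

Lemma lcoef_sum (I : finType) (f : I -> laurent F) n :
  (\sum_i f i) n = \sum_i f i n.
Proof. by elim/big_rec2: _ => //= i a b _ <-. Qed.

Lemma lcoef_poly (p : {poly F}) (k : nat) : poly_laurent p (- k%:Z) = p`_k.
Proof.
rewrite /poly_laurent /horner_morph horner_coef lcoef_sum.
have coefE i : ((map_poly lconst p)`_i * ltheta ^+ i) (- k%:Z) =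
    if i == k then p`_k else 0.
  rewrite coef_map /= [LHS]lmul_monoE ltheta_exp /= subr0.
  have -> : (- k%:Z == - i%:Z) = (i == k) by apply/eqP/eqP; lia.
  by case: eqP => [->|_]; rewrite ?mulr1 ?mulr0.
under eq_bigr do rewrite coefE.
have [lek|ltk] := leqP (size p) k.
  rewrite nth_default// big1// => i _; case: ifP => //.
rewrite -(size_map_poly lconst) in ltk.
rewrite (bigD1 (Ordinal ltk)) //= eqxx big1 ?addr0 // => i.
by rewrite -val_eqE /= => /negPf ->.
Qed.

Lemma poly_laurent_eq0 (p : {poly F}) : (poly_laurent p == 0) = (p == 0).
Proof.
apply/eqP/eqP => [p0|->]; last exact: rmorph0.
by apply/polyP => k; rewrite -lcoef_poly p0 coef0.
Qed.

(* The embedding of F(theta) in F((1/theta)). *)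
Definition ratfun_laurent (x : ratfun F) : laurent F :=
  poly_laurent \n_(repr x) / poly_laurent \d_(repr x).

Lemma ratfunE (x : ratfun F) :
  x * tofrac \d_(repr x) = tofrac \n_(repr x).
Proof.
rewrite -{1}[x]reprK; move: (repr x) => r.
rewrite /tofrac; unlock FracField.tofrac; rewrite -[LHS]FracField.pi_mul.
apply/eqmodP; rewrite /= FracField.equivfE /FracField.mulf.
by rewrite !numden_Ratio ?mulr1 ?oner_neq0 ?denom_ratioP// mulrC.
Qed.

Lemma ratfun_laurentE (x : ratfun F) (n d : {poly F}) : d != 0 ->
  x * tofrac d = tofrac n ->
  ratfun_laurent x = poly_laurent n / poly_laurent d.
Proof.
move=> d0 xE; have xR := ratfunE x; have dR := denom_ratioP (repr x).
apply/eqP; rewrite eqr_div ?poly_laurent_eq0// -!rmorphM /=; apply/eqP.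
congr poly_laurent; apply/eqP; rewrite -tofrac_eq !rmorphM /= -xE -xR.
by rewrite mulrAC.
Qed.

Fact ratfun_laurent_zmod : zmod_morphism ratfun_laurent.
Proof.
move=> x y; have [xR yR] := (ratfunE x, ratfunE y).
rewrite {2 3}/ratfun_laurent.
move: (denom_ratioP (repr x)) (denom_ratioP (repr y)) xR yR.
move: (\n_(repr x)) (\d_(repr x)) (\n_(repr y)) (\d_(repr y)).
move=> a b c d b0 d0 xR yR.
rewrite (@ratfun_laurentE _ (a * d - c * b) (b * d)) ?mulf_neq0//; last first.
  by rewrite rmorphB !rmorphM /= -xR -yR mulrBl; congr (_ - _);
     rewrite -!mulrA; congr (_ * _); rewrite mulrC.
rewrite rmorphB !rmorphM /=.
by rewrite -[- (_ / _)]mulNr addf_div ?poly_laurent_eq0// mulNr.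
Qed.

Fact ratfun_laurent_monoid : monoid_morphism ratfun_laurent.
Proof.
split=> [|x y].
  by rewrite (@ratfun_laurentE _ 1 1) ?oner_neq0 ?rmorph1 ?mulr1 ?divr1.
have [xR yR] := (ratfunE x, ratfunE y).
rewrite {2 3}/ratfun_laurent.
move: (denom_ratioP (repr x)) (denom_ratioP (repr y)) xR yR.
move: (\n_(repr x)) (\d_(repr x)) (\n_(repr y)) (\d_(repr y)).
move=> a b c d b0 d0 xR yR.
rewrite (@ratfun_laurentE _ (a * c) (b * d)) ?mulf_neq0//; last first.
  by rewrite !rmorphM /= -xR -yR mulrACA.
by rewrite !rmorphM /= mulf_div.
Qed.

HB.instance Definition _ := GRing.isZmodMorphism.Build
  (ratfun F) (laurent F) ratfun_laurent ratfun_laurent_zmod.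
HB.instance Definition _ := GRing.isMonoidMorphism.Build
  (ratfun F) (laurent F) ratfun_laurent ratfun_laurent_monoid.

Definition lscale (a : ratfun F) (x : laurent F) := ratfun_laurent a * x.

Fact lscaleA a b x : lscale a (lscale b x) = lscale (a * b) x.
Proof. by rewrite /lscale rmorphM mulrA. Qed.
Fact lscale1 : left_id 1 lscale.
Proof. by move=> x; rewrite /lscale rmorph1 mul1r. Qed.
Fact lscaleDr : right_distributive lscale +%R.
Proof. by move=> a x y; rewrite /lscale mulrDr. Qed.
Fact lscaleDl x : {morph lscale^~ x : a b / a + b}.
Proof. by move=> a b; rewrite /lscale rmorphD mulrDl. Qed.
HB.instance Definition _ := GRing.Zmodule_isLmodule.Build (ratfun F)
  (laurent F) lscaleA lscale1 lscaleDr lscaleDl.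

End Embedding.

Definition lspan (K : fieldType) (V : lmodType K) (A : set V) : set V :=
  [set x | exists (n : nat) (c : 'I_n -> K) (v : 'I_n -> V),
    (forall i, A (v i)) /\ x = \sum_(i < n) c i *: v i].

Definition generates (K : fieldType) (V : lmodType K) (A U : set V) : Prop :=
  A `<=` U /\ lspan A = U.

Section Polylogarithms.
Variable F : finFieldType.

Definition theta : ratfun F := tofrac 'X.

Definition ell (d : nat) : ratfun F :=
  \prod_(1 <= i < d.+1) (theta - theta ^+ (#|F| ^ i)).

Definition acmpl_term (n : nat) (eps : 'I_n -> F) (s d : 'I_n -> nat) :
    ratfun F :=
  \prod_(i < n) (tofrac (eps i)%:P ^+ d i / ell (d i) ^+ s i).

Definition decreasing (n D : nat) (d : {ffun 'I_n -> 'I_D}) : bool :=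
  [forall i : 'I_n, forall j : 'I_n, (i < j)%N ==> (d j < d i)%N].

(* The infinite sum over d_1 > ... > d_n >= 0 is the limit, as D tends to
   infinity, of the finite sums over D > d_1 > ... > d_n >= 0. *)
Definition acmpl (n : nat) (eps : 'I_n -> F) (s : 'I_n -> nat) : laurent F :=
  limn (fun D : nat =>
    \sum_(d : {ffun 'I_n -> 'I_D} | decreasing d)
      ratfun_laurent (acmpl_term eps s (fun i => d i))).

Definition admissible (n : nat) (eps : 'I_n -> F) (s : 'I_n -> nat) (w : nat) :
    Prop :=
  [/\ forall i, eps i != 0, forall i, (0 < s i)%N & (\sum_(i < n) s i = w)%N].

Definition acmpls (w : nat) : set (laurent F) :=
  [set x | exists (n : nat) (eps : 'I_n -> F) (s : 'I_n -> nat),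
    admissible eps s w /\ x = acmpl eps s].

Definition AL (w : nat) : set (laurent F) := lspan (acmpls w).

Definition AT (w : nat) : set (laurent F) :=
  [set x | exists (n : nat) (eps : 'I_n -> F) (s : 'I_n -> nat),
    [/\ admissible eps s w,
        forall i : 'I_n, (i.+1 < n)%N -> (s i <= #|F|)%N,
        forall i : 'I_n, i.+1 = n -> (s i < #|F|)%N
      & x = acmpl eps s]].

End Polylogarithms.

Arguments AL : clear implicits.
Arguments AT : clear implicits.

(* Main.v *)
(* Encode an array by the word of its letters x_(s,eps). Truncating all sums at
   d_1 < D, the telescoping identity
     sum_(j <= d) 1/ell_j^(q-1) = ell_(d+1) / (ell_1 ell_d^q)
   multiplied by the truncated sum of a word v gives, after summation over d and
   insertion behind a prefix u = u' x_(t,eta), with c = ell_1 / eps and * the stuffle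
   product,
     u x_(q,eps) v + u (x_(q,eps) o v)
       = c (u x_(1,eps) (x_(q-1,1) * v) + u' x_(t+1,eta eps) (x_(q-1,1) * v)),
   where x_(q,eps) o v adds q to the first exponent of v, and the last term is absent in
   the limit when u is empty. With v = x_(s,1) v' this rewrites an exponent q + s, and
   with v empty it rewrites a final exponent q. Every new word is either longer, or
   equally long and lexicographically larger; since the weight is fixed, the rewriting
   terminates, and it can only stop on words from AT. *)
Require Import Defs.
From mathcomp Require Import all_boot all_order all_algebra all_solvable all_field.
From mathcomp Require Import boolp classical_sets topology zify ring.

(** * Linear spans *)

Section Span.
Set Implicit Arguments.
Unset Strict Implicit.
Import GRing.Theory.
Local Open Scope classical_set_scope.
Local Open Scope ring_scope.
Variables (K : fieldType) (V : lmodType K).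
Implicit Types (A B : set V) (x y : V).

Lemma lspan0 A : lspan A 0.
Proof. by exists 0%N, (fun=> 0), (fun=> 0); split=> [[]|]; rewrite ?big_ord0. Qed.

Lemma lspan_sub A : A `<=` lspan A.
Proof.
by move=> x Ax; exists 1%N, (fun=> 1), (fun=> x); split=> //; rewrite big_ord1 scale1r.
Qed.

Lemma lspanZ A c x : lspan A x -> lspan A (c *: x).
Proof.
move=> [n [a [v [Av ->]]]]; exists n, (fun i => c * a i), v; split=> //.
by rewrite scaler_sumr; apply: eq_bigr => i _; rewrite scalerA.
Qed.

Lemma lspanD A x y : lspan A x -> lspan A y -> lspan A (x + y).
Proof.
move=> [n [a [v [Av ->]]]] [m [b [w [Aw ->]]]].
exists (n + m)%N, (fun i => match fintype.split i with inl j => a j | inr j => b j end),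
  (fun i => match fintype.split i with inl j => v j | inr j => w j end); split.
  by move=> i; case: (fintype.split i).
rewrite big_split_ord /=; congr (_ + _); apply: eq_bigr => i _.
  by rewrite (unsplitK (inl i)).
by rewrite (unsplitK (inr i)).
Qed.

Lemma lspanB A x y : lspan A x -> lspan A y -> lspan A (x - y).
Proof. by move=> Ax Ay; rewrite -scaleN1r; apply: lspanD Ax (lspanZ _ Ay). Qed.

Lemma lspan_sum A (I : Type) (r : seq I) (P : pred I) (f : I -> V) :
  (forall i, P i -> lspan A (f i)) -> lspan A (\sum_(i <- r | P i) f i).
Proof. by move=> Af; elim/big_rec: _ => [|i x /Af]; [exact: lspan0 | exact: lspanD]. Qed.

Lemma lspan_sum_seq A (I : eqType) (r : seq I) (f : I -> V) :
  {in r, forall i, lspan A (f i)} -> lspan A (\sum_(i <- r) f i).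
Proof. by move=> Af; rewrite big_seq; apply: lspan_sum. Qed.

Lemma lspan_min A B : A `<=` lspan B -> lspan A `<=` lspan B.
Proof.
by move=> AB _ [n [c [v [Av ->]]]]; apply: lspan_sum => i _; apply/lspanZ/AB.
Qed.

End Span.

(** * Orders and limits of Laurent series *)

Section LaurentLimits.
Set Implicit Arguments.
Unset Strict Implicit.
Import Order.TTheory GRing.Theory Num.Theory.
Local Open Scope classical_set_scope.
Local Open Scope ring_scope.
Variable F : fieldType.
Implicit Types x y : laurent F.

(** A lower bound [N] on the (1/theta)-adic valuation, put on coefficients so that zero satisfies it
    for every [N]. *)
Definition ord_ge (N : int) (x : laurent F) := forall n : int, n < N -> x n = 0.

Lemma ord_geD N x y : ord_ge N x -> ord_ge N y -> ord_ge N (x + y).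
Proof. by move=> xN yN n nN; rewrite /= xN ?yN ?addr0. Qed.

Lemma ord_geM N M x y : ord_ge N x -> ord_ge M y -> ord_ge (N + M) (x * y).
Proof.
move=> xN yM n nNM; rewrite [LHS](@lconvE F N 0) ?big_ord0 // => i iN.
by apply: yM; lia.
Qed.

Lemma ord_ge_le M N x : M <= N -> ord_ge N x -> ord_ge M x.
Proof. by move=> MN xN n nM; apply: xN; apply: lt_le_trans MN. Qed.

Lemma ord_ge1 : ord_ge 0 1.
Proof. by move=> n n0 /=; rewrite ifF //; lia. Qed.

(** The bound stays [N] instead of [k * N], which is enough for convergence; [0 < k] excludes
    [x ^+ 0 = 1], whose order is 0. *)
Lemma ord_geX (k : nat) N x : 0 <= N -> (0 < k)%N -> ord_ge N x -> ord_ge N (x ^+ k).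
Proof.
move=> N0; case: k => // k _ xN; elim: k => [|k IH]; first by rewrite expr1.
by rewrite exprS; apply: ord_ge_le (ord_geM xN IH); lia.
Qed.

Lemma ord_ge_inv (N : int) (x : laurent F) : x (- N) != 0 -> ord_ge (- N) x -> ord_ge N x^-1.
Proof.
move=> xN0 xN; have x0 : x != 0 by apply: contra_neq xN0 => ->.
have := invr_neq0 x0 => /lval_ex [v [yv yN]].
(* At the sum of the two leading indices the product has the product of the leading coefficients; as
   the product is 1, that sum must be 0. *)
have : (x * x^-1) (- N + v) != 0.
  rewrite [X in X != 0](@lconvE F (- N) 1) // => [|i iv]; last by apply: yN; lia.
  by rewrite big_ord_recl big_ord0 /= !addr0 mulf_neq0 // addrAC subrr add0r.
rewrite divff //= ; case: ifP => [/eqP vN _|]; last by rewrite eqxx.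
by move=> n nN; apply: yN; lia.
Qed.

(** Completeness: step [D] leaves all coefficients of index below [D] unchanged, so each coefficient
    is eventually constant. *)
Lemma laurent_cvg_stable (u : nat -> laurent F) :
  (forall D : nat, ord_ge D (u D.+1 - u D)) -> exists x : laurent F, u @ \oo --> x.
Proof.
move=> uS; have [N uN] := laurent_bounded (u 0%N).
have stab D k n : (n < D%:Z) -> (D <= k)%N -> u k n = u D n.
  move=> nD; elim: k => [|k IH]; first by rewrite leqn0 => /eqP ->.
  rewrite leq_eqVlt => /predU1P[->//|Dk]; rewrite -IH //.
  have /(_ k n) := uS => /(_ _)/eqP; rewrite /= subr_eq0 => /(_ _)/eqP; apply.
  by move: Dk; lia.
(* A coefficient of index [n >= 0] is final from step |n| + 1 on, one of negative index from the
   start. *)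
pose f (n : int) := if n < 0 then u 0%N n else u (absz n).+1 n.
have fP : exists N : int, forall n, n < N -> f n = 0.
  exists (Num.min N 0) => n; rewrite lt_min => /andP[nN n0].
  by rewrite /f n0 uN.
exists (Laurent fP); apply/laurent_cvgP => M; exists (absz M) => k Mk n nM /=.
rewrite /f; case: ltP => n0; first by rewrite (stab 0%N).
by rewrite -(stab _ k) //; lia.
Qed.

Lemma laurent_cvg_ordP (u : nat -> laurent F) (x : laurent F) :
  u @ \oo --> x <-> forall N : int, exists D : nat, forall k, (D <= k)%N -> ord_ge N (u k - x).
Proof.
split=> [/laurent_cvgP ux N | ux].
  have [D uD] := ux N; exists D => k Dk n nN /=.
  by rewrite (uD k Dk n nN) subrr.
apply/laurent_cvgP => N; have [D uD] := ux N; exists D => k Dk n nN.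
by have := uD k Dk n nN => /eqP; rewrite /= subr_eq0 => /eqP.
Qed.

Lemma laurent_cvgD (u v : nat -> laurent F) (x y : laurent F) :
  u @ \oo --> x -> v @ \oo --> y -> (fun D => u D + v D) @ \oo --> x + y.
Proof.
move=> /laurent_cvg_ordP ux /laurent_cvg_ordP vy; apply/laurent_cvg_ordP => N.
have [[A uA] [B vB]] := (ux N, vy N); exists (maxn A B) => k; rewrite geq_max => /andP[Ak Bk].
by rewrite opprD addrACA; apply: ord_geD; [exact: uA | exact: vB].
Qed.

Lemma laurent_cvgM c (u : nat -> laurent F) (x : laurent F) :
  u @ \oo --> x -> (fun D => c * u D) @ \oo --> c * x.
Proof.
move=> /laurent_cvg_ordP ux; apply/laurent_cvg_ordP => N.
have [M cM] := laurent_bounded c; have [D uD] := ux (N - M); exists D => k Dk.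
by rewrite -mulrBr; apply: (@ord_ge_le _ (M + (N - M))); [lia | apply: ord_geM (uD k Dk)].
Qed.

Lemma laurent_cvg_sum (I : eqType) (r : seq I) (u : I -> nat -> laurent F) (x : I -> laurent F) :
  {in r, forall i, u i @ \oo --> x i} ->
  (fun D => \sum_(i <- r) u i D) @ \oo --> \sum_(i <- r) x i.
Proof.
elim: r => [|i r IH] ur.
  under eq_fun do rewrite big_nil.
  by rewrite big_nil; exact: cvg_cst.
under eq_fun do rewrite big_cons.
rewrite big_cons; apply: laurent_cvgD; first by apply: ur; rewrite mem_head.
by apply: IH => j jr; apply: ur; rewrite inE jr orbT.
Qed.

Lemma laurent_cvg_eq (u v : nat -> laurent F) (x y : laurent F) :
  u @ \oo --> x -> v @ \oo --> y -> u =1 v -> x = y.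
Proof.
move=> ux vy /funext uv; rewrite uv in ux.
by rewrite -(cvg_lim (@laurent_hausdorff F) ux) -(cvg_lim (@laurent_hausdorff F) vy).
Qed.

(** Serves the relation for an empty prefix, whose right side is truncated at [D.+1]. *)
Lemma laurent_cvgS (u : nat -> laurent F) (x : laurent F) :
  u @ \oo --> x -> (fun D => u D.+1) @ \oo --> x.
Proof.
move=> /laurent_cvgP ux; apply/laurent_cvgP => N; have [D uD] := ux N.
by exists D => k Dk; apply: uD; apply: leqW.
Qed.

End LaurentLimits.

(** * Truncated sums of words and the stuffle product with a letter *)

Section Words.
Set Implicit Arguments.
Unset Strict Implicit.
Import Order.TTheory GRing.Theory Num.Theory.
Local Open Scope classical_set_scope.
Local Open Scope ring_scope.
Variable F : finFieldType.
Local Notation q := #|F|.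
Local Notation K := (ratfun F).
Local Notation word := (seq (nat * F)).
Implicit Types (a b : nat * F) (u v w : word).

Definition letter_term a (d : nat) : K := tofrac a.2%:P ^+ d / ell F d ^+ a.1.

(** The sum over D > d_1 > ... > d_n >= 0, nested so that the largest index bounds the tail; a step
    in [D] then adds a single term. *)
Fixpoint power_sum w (D : nat) : K :=
  if w is a :: v then \sum_(d < D) letter_term a d * power_sum v d else 1.

Lemma power_sum_nil D : power_sum [::] D = 1.
Proof. by []. Qed.

Lemma power_sum0 a w : power_sum (a :: w) 0 = 0.
Proof. by rewrite /= big_ord0. Qed.

Lemma power_sumS a w D :
  power_sum (a :: w) D.+1 = power_sum (a :: w) D + letter_term a D * power_sum w D.
Proof. by rewrite /= big_ord_recr. Qed.

Arguments power_sum : simpl never.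

Definition letter_mul a b : nat * F := ((a.1 + b.1)%N, a.2 * b.2).

(* The terms, with multiplicity, of the stuffle product of the letter a and the word w. *)
Fixpoint stuffle1 a w : seq word :=
  if w is b :: v then
    [:: a :: w, letter_mul a b :: v & [seq b :: z | z <- stuffle1 a v]]
  else [:: [:: a]].

Lemma letter_termM a b d :
  letter_term (letter_mul a b) d = letter_term a d * letter_term b d.
Proof.
rewrite /letter_term /= polyCM rmorphM /= exprMn exprD invfM.
ring.
Qed.

(** By induction on [w], then on [D]: the new index may be taken by [a] alone, by both first
    letters, or by the first letter of [w] alone. These are the three kinds of stuffle terms. *)
Lemma power_sum_stuffle1 a w D :
  power_sum [:: a] D * power_sum w D = \sum_(z <- stuffle1 a w) power_sum z D.
Proof.
elim: w D => [|b v IH] D; first by rewrite big_seq1 mulr1.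
rewrite !big_cons big_map.
elim: D => [|D IHD]; first by rewrite !power_sum0 mul0r big1 ?addr0 // => z _; rewrite power_sum0.
under eq_bigr do rewrite power_sumS.
rewrite big_split /= -mulr_sumr -IH !power_sumS letter_termM.
transitivity (power_sum [:: a] D * power_sum (b :: v) D +
  (letter_term a D * power_sum (b :: v) D
   + letter_term a D * (letter_term b D * power_sum v D)
   + letter_term b D * (power_sum [:: a] D * power_sum v D))).
  by rewrite power_sum_nil; ring.
by rewrite IHD; ring.
Qed.

(** * The products ell_d and the telescoping identity *)

Lemma theta_sub_neq0 i : (0 < i)%N -> theta F - theta F ^+ (q ^ i) != 0.
Proof.
move=> i0; rewrite subr_eq0 /theta -rmorphXn /= tofrac_eq.
apply/eqP => /(congr1 (fun p : {poly F} => size p)).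
rewrite size_polyX size_polyXn => -[] qi.
have q1 := finNzRing_gt1 F.
have : (q ^ 0 < q ^ i)%N by rewrite ltn_exp2l.
by rewrite -qi.
Qed.

Lemma ellS d : ell F d.+1 = ell F d * (theta F - theta F ^+ (q ^ d.+1)).
Proof. by rewrite /ell big_nat_recr. Qed.

Lemma ell0 : ell F 0 = 1.
Proof. by rewrite /ell big_geq. Qed.

Lemma ell_neq0 d : ell F d != 0.
Proof.
elim: d => [|d IH]; first by rewrite ell0 oner_neq0.
by rewrite ellS; apply: mulf_neq0; [exact: IH | exact: theta_sub_neq0].
Qed.

Lemma exprB_card (x y : K) : (x - y) ^+ q = x ^+ q - y ^+ q.
Proof.
have [p _ pF] := finPcharP F.
have pK : p \in [pchar K].
  exact: (rmorph_pchar (@tofrac {poly F} : {rmorphism _ -> _}) (rmorph_pchar polyC pF)).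
(* The additive group of [F] is an elementary abelian p-group, so [q] is a power of p. *)
have qK : [pchar K].-nat q.
  have := abelem_pgroup (fin_ring_pchar_abelem pF).
  by rewrite /pgroup cardsT => /pi_pnat; exact.
have := exprDn_pchar (x - y) y qK; rewrite subrK => ->; ring.
Qed.

(** Additivity of the q-th power gives theta - theta^(q^(d+1)) = (theta - theta^q) + (theta -
    theta^(q^d))^q. *)
Lemma ell_frobenius d :
  ell F d.+1 = ell F 1 * ell F d + ell F d * (theta F - theta F ^+ (q ^ d)) ^+ q.
Proof.
rewrite exprB_card -exprM -expnSr ellS /ell big_nat1 expn1; ring.
Qed.

(** The induction step of the telescoping identity, with l = ell_1, a = ell_(d+1), b = ell_d and n =
    q - 1. *)
Lemma power_sum_q1_step (R : fieldType) (l a b : R) n : l != 0 -> a != 0 -> b != 0 ->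
  a / (l * b ^+ n.+1) + (a ^+ n)^-1 =
  (l * a + a * (a / b) ^+ n.+1) / (l * a ^+ n.+1).
Proof.
move=> l0 a0 b0; have [x0 y0] := (expf_neq0 n a0, expf_neq0 n.+1 b0).
rewrite expr_div_n [a ^+ n.+1]exprS.
by move: (a ^+ n) (b ^+ n.+1) x0 y0 => x y x0 y0; field; rewrite x0 y0 l0 a0.
Qed.

(** [ell_frobenius] splits ell_(d+2) into two parts: one yields the new term 1/ell_(d+1)^(q-1), the
    other the previous sum. *)
Lemma power_sum_q1 d :
  power_sum [:: (q.-1, 1)] d.+1 = ell F d.+1 / (ell F 1 * ell F d ^+ q).
Proof.
have q0 : (0 < q)%N := ltnW (finNzRing_gt1 F).
have l10 := ell_neq0 1.
elim: d => [|d IH].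
  rewrite power_sumS power_sum0 power_sum_nil /letter_term expr0 ell0 !expr1n.
  by rewrite invr1 !mulr1 add0r divff.
have ld0 := ell_neq0 d; have ld10 := ell_neq0 d.+1.
rewrite power_sumS IH /letter_term /= rmorph1 expr1n mulr1 div1r.
rewrite (ell_frobenius d.+1).
have -> : theta F - theta F ^+ (q ^ d.+1) = ell F d.+1 / ell F d.
  by rewrite ellS [X in _ = X / _]mulrC (mulfK ld0).
by have := power_sum_q1_step q.-1 l10 ld10 ld0; rewrite (prednK q0).
Qed.

(* Since D = theta^q - theta is -ell_1, this is the usual coefficient -D / eps. *)
Definition carlitz_coef (e : F) : K := ell F 1 / tofrac e%:P.

(** * Relations between truncated sums *)

Lemma tofrac_polyC_neq0 (e : F) : e != 0 -> (tofrac e%:P : K) != 0.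
Proof. by rewrite tofrac_eq0 polyC_eq0. Qed.

Lemma carlitz_relation_step (R : fieldType) (l a b c x y : R) :
  l != 0 -> a != 0 -> b != 0 -> c != 0 ->
  y / b * x = l / c * (c * y / a * (a / (l * b) * x)).
Proof. by move=> l0 a0 b0 c0; field; rewrite l0 a0 b0 c0. Qed.

(** The stuffle terms add up to the product of the sums of [(q.-1, 1)] and [v]. In the closed form
    of the first, the numerator ell_(d+1) cancels the denominator of the letter [(1, e)] and leaves
    ell_d^q. *)
Lemma carlitz_relation e v d : e != 0 ->
  letter_term (q, e) d * power_sum v d.+1 =
  carlitz_coef e *
    \sum_(z <- stuffle1 (q.-1, 1) v) letter_term (1%N, e) d.+1 * power_sum z d.+1.
Proof.
move=> /tofrac_polyC_neq0 e0.
rewrite -mulr_sumr -power_sum_stuffle1 power_sum_q1 /carlitz_coef /letter_term /= exprS.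
have l1 := ell_neq0 1; have ldS := ell_neq0 d.+1; have ldq := expf_neq0 q (ell_neq0 d).
rewrite (expr1 (ell F d.+1)).
by rewrite (carlitz_relation_step (power_sum v d.+1) (tofrac e%:P ^+ d) l1 ldS ldq e0).
Qed.

(* At most one word: multiplying by an empty w leaves no diagonal term. *)
Definition absorb a w : seq word := if w is b :: v then [:: letter_mul a b :: v] else [::].

(** Raising the bound from d to d + 1 lets the first letter of [w] sit at d together with [a]. The
    extra term is written as an increment so that it telescopes over d. *)
Lemma letter_term_absorb a w d :
  letter_term a d * power_sum w d.+1 =
  letter_term a d * power_sum w d + \sum_(z <- absorb a w) (power_sum z d.+1 - power_sum z d).
Proof.
case: w => [|b v]; first by rewrite big_nil addr0.
by rewrite big_seq1 !power_sumS letter_termM; ring.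
Qed.

Lemma stuffle1_neq0 a w z : z \in stuffle1 a w -> z != [::].
Proof.
case: w => [|b v]; rewrite !inE; first by move=> /eqP ->.
by case/or3P => [/eqP -> | /eqP -> | /mapP [y _ ->]].
Qed.

Lemma power_sum_stuffle0 a w z : z \in stuffle1 a w -> power_sum z 0 = 0.
Proof. by move/stuffle1_neq0; case: z => // b v _; rewrite power_sum0. Qed.

(** [carlitz_relation] summed over d < D; its right side lives at index d + 1, whence the bound
    [D.+1]. *)
Lemma carlitz_relation_sum e v D : e != 0 ->
  power_sum ((q, e) :: v) D + \sum_(z <- absorb (q, e) v) power_sum z D =
  carlitz_coef e * \sum_(z <- stuffle1 (q.-1, 1) v) power_sum ((1%N, e) :: z) D.+1.
Proof.
move=> e0; elim: D => [|D IH].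
  (* Index 0 contributes nothing on the right: stuffle terms are nonempty words, and their sums
     truncated at 0 vanish. *)
  rewrite power_sum0 add0r !big_seq !big1 ?mulr0 // => z.
    by move=> /power_sum_stuffle0; rewrite power_sumS power_sum0 => ->; rewrite mulr0 addr0.
  by case: v => //= b v; rewrite inE => /eqP ->; rewrite power_sum0.
rewrite power_sumS.
under [X in _ = _ * X]eq_bigr do rewrite power_sumS.
rewrite big_split mulrDr /= -IH -carlitz_relation // letter_term_absorb.
rewrite sumrB; ring.
Qed.

(** With [a] at index d, the right side of [carlitz_relation_sum] is truncated at d + 1, so the
    letter [(1, e)] may sit at d and merge with [a]: this is the second family of words. Each letter
    of [u] adds one more summation. *)
Lemma carlitz_relation_prefix u a e v D : e != 0 ->
  power_sum (u ++ a :: (q, e) :: v) D +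
    \sum_(z <- absorb (q, e) v) power_sum (u ++ a :: z) D =
  carlitz_coef e * \sum_(z <- stuffle1 (q.-1, 1) v)
    (power_sum (u ++ a :: (1%N, e) :: z) D + power_sum (u ++ letter_mul a (1%N, e) :: z) D).
Proof.
move=> e0; elim: u D => [|b u IHu]; elim=> [|D IHD] /=.
- by rewrite !power_sum0 !big1 ?mulr0 ?addr0 // => z _; rewrite !power_sum0 ?addr0.
- move: IHD => /= IHD; rewrite power_sumS.
  under eq_bigr do rewrite power_sumS.
  under [in RHS]eq_bigr do rewrite !power_sumS letter_termM addrACA -mulrA -mulrDr -power_sumS.
  rewrite [in LHS]big_split [in RHS]big_split /= mulrDr -[in RHS]IHD -!mulr_sumr.
  rewrite mulrCA -carlitz_relation_sum //; ring.
- by rewrite !power_sum0 !big1 ?mulr0 ?addr0 // => z _; rewrite !power_sum0 ?addr0.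
move: IHD => /= IHD; rewrite power_sumS.
under eq_bigr do rewrite power_sumS.
under [in RHS]eq_bigr do rewrite !power_sumS addrACA -mulrDr.
by rewrite [in LHS]big_split [in RHS]big_split /= mulrDr -[in RHS]IHD -!mulr_sumr mulrCA -IHu; ring.
Qed.

(** * Orders of the terms and convergence *)

Lemma ord_ge_theta_sub i : (0 < i)%N ->
  ord_ge 1 (ratfun_laurent (theta F - theta F ^+ (q ^ i)))^-1.
Proof.
move=> i0; have q1 : (1 < q ^ i)%N.
  by rewrite -(expn0 q) ltn_exp2l // finNzRing_gt1.
have -> : ratfun_laurent (theta F - theta F ^+ (q ^ i)) = ltheta F - ltheta F ^+ (q ^ i).
  rewrite rmorphB rmorphXn /= (_ : ratfun_laurent (theta F) = ltheta F) //.
  rewrite (@ratfun_laurentE F _ 'X 1) ?oner_neq0 ?tofrac1 ?mulr1 // rmorph1 divr1.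
  by rewrite /poly_laurent horner_morphX.
(* The dominant term theta^(q^i) gives order q^i; order 1 per factor already makes 1/ell_d tend to
   0. *)
apply: (@ord_ge_le _ _ (q ^ i)%N); first lia.
have cE n : (ltheta F - ltheta F ^+ (q ^ i)) n =
    (if n == -1 then 1 else 0) - (if n == - (q ^ i)%N%:Z then 1 else 0).
  by rewrite ltheta_exp.
apply: ord_ge_inv => [|n nq]; rewrite cE.
  by rewrite eqxx ifF ?sub0r ?oppr_eq0 ?oner_neq0 //; lia.
by rewrite !ifF ?subr0 //; lia.
Qed.

Lemma ord_ge_ell (d : nat) : ord_ge d (ratfun_laurent (ell F d))^-1.
Proof.
elim: d => [|d IH]; first by rewrite ell0 rmorph1 invr1; exact: ord_ge1.
rewrite ellS rmorphM invfM; apply: (@ord_ge_le _ _ (d%:Z + 1)); first lia.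
by apply: ord_geM => //; apply: ord_ge_theta_sub.
Qed.

Lemma ratfun_laurent_const (e : F) : ratfun_laurent (tofrac e%:P) = lconst e.
Proof.
rewrite (@ratfun_laurentE F _ e%:P 1) ?oner_neq0 ?tofrac1 ?mulr1 // rmorph1 divr1.
by rewrite /poly_laurent horner_morphC.
Qed.

Lemma ord_ge_letter_term a (d : nat) : (0 < a.1)%N -> ord_ge d (ratfun_laurent (letter_term a d)).
Proof.
move=> a0; rewrite /letter_term rmorphM fmorphV !rmorphXn /= ratfun_laurent_const.
rewrite -rmorphXn -exprVn -[d%:Z]add0r.
apply: ord_geM; first by move=> n n0 /=; rewrite ifF //; lia.
by apply: ord_geX => //; exact: ord_ge_ell.
Qed.

Definition valid_letter a := (0 < a.1)%N && (a.2 != 0).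

Lemma ord_ge_power_sum w D : all valid_letter w -> ord_ge 0 (ratfun_laurent (power_sum w D)).
Proof.
elim: w D => [|a w IH] D; first by move=> _; rewrite power_sum_nil rmorph1; exact: ord_ge1.
move=> /= /andP[/andP[a0 _] /IH {}IH]; elim: D => [|D IHD]; first by rewrite power_sum0 rmorph0.
have aD : ord_ge 0 (ratfun_laurent (letter_term a D)).
  by have := ord_ge_letter_term (d := D) a0; apply: ord_ge_le.
rewrite power_sumS rmorphD rmorphM; apply: ord_geD IHD _.
exact: ord_geM aD (IH D).
Qed.

Definition li w : laurent F := limn (fun D => ratfun_laurent (power_sum w D)).

(** For a nonempty word the increment at [D] is its first letter at index [D], of order at least
    [D], times a truncated sum of order at least 0. *)
Lemma power_sum_cvg w : all valid_letter w ->
  (fun D => ratfun_laurent (power_sum w D)) @ \oo --> li w.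
Proof.
move=> vw.
have [|x ux] := @laurent_cvg_stable F (fun D => ratfun_laurent (power_sum w D)).
  move=> D; rewrite -rmorphB.
  case: w vw => [_|a w /= /andP[/andP[a0 _] vw]].
    by rewrite !power_sum_nil subrr rmorph0.
  rewrite power_sumS addrAC subrr add0r rmorphM -[D%:Z]addr0.
  exact: ord_geM (@ord_ge_letter_term a D a0) (@ord_ge_power_sum w D vw).
by rewrite /li (cvg_lim (@laurent_hausdorff F) ux).
Qed.


(** * Weight, length and validity of words *)

Definition weight w := (\sum_(a <- w) a.1)%N.

Lemma weight_cat u w : weight (u ++ w) = (weight u + weight w)%N.
Proof. exact: big_cat. Qed.

Lemma weight_cons a w : weight (a :: w) = (a.1 + weight w)%N.
Proof. exact: big_cons. Qed.

Lemma valid_letter_mul a b :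
  valid_letter a -> valid_letter b -> valid_letter (letter_mul a b).
Proof.
move=> /andP[a1 a2] /andP[_ b2]; apply/andP; split; first by rewrite ltn_addr.
exact: mulf_neq0.
Qed.

Lemma stuffle1_valid a w z : valid_letter a -> all valid_letter w ->
  z \in stuffle1 a w -> all valid_letter z.
Proof.
move=> va; elim: w z => [|b v IH] z /=; first by rewrite inE => _ /eqP -> /=; rewrite va.
move=> /andP[vb vv]; rewrite !inE => /or3P[/eqP->|/eqP->|/mapP[y /(IH _ vv) vy ->]] /=.
- by rewrite va vb.
- by rewrite valid_letter_mul.
- by rewrite vb.
Qed.

Lemma stuffle1_weight a w z : z \in stuffle1 a w -> weight z = (a.1 + weight w)%N.
Proof.
elim: w z => [|b v IH] z /=; first by rewrite inE => /eqP ->; rewrite weight_cons.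
rewrite !inE => /or3P[/eqP->|/eqP->|/mapP[y /IH wy ->]]; rewrite !weight_cons //.
  by rewrite addnA.
by rewrite wy; lia.
Qed.

(** The [maxn 1] accounts for an empty [w], where the product is the word [[:: a]]. *)
Lemma stuffle1_size a w z : z \in stuffle1 a w -> (maxn 1 (size w) <= size z)%N.
Proof.
elim: w z => [|b v IH] z /=; first by rewrite inE => /eqP ->.
rewrite !inE geq_max => /or3P[/eqP->|/eqP->|/mapP[y /IH wy ->]] /=; rewrite ?leqnn ?leqnSn //.
by rewrite ltnS (leq_trans (leq_maxr _ _) wy).
Qed.

Lemma absorb_valid a w z : valid_letter a -> all valid_letter w ->
  z \in absorb a w -> all valid_letter z.
Proof.
case: w => [|b w] //= va /andP[vb vw]; rewrite inE => /eqP -> /=.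
by rewrite valid_letter_mul.
Qed.

Lemma card_gt1 : (1 < q)%N. Proof. exact: finNzRing_gt1. Qed.

Lemma valid_card_pred : valid_letter (q.-1, 1 : F).
Proof. by rewrite /valid_letter oner_neq0 andbT /=; have := card_gt1; case: (q) => [|[]]. Qed.

Lemma valid_card e : e != 0 -> valid_letter (q, e).
Proof. by move=> e0; rewrite /valid_letter e0 andbT ltnW // card_gt1. Qed.

(** * Relations between limits *)

Lemma li_sum_cvg (r : seq word) (f : word -> word) :
  {in r, forall z, all valid_letter (f z)} ->
  (fun D => \sum_(z <- r) ratfun_laurent (power_sum (f z) D)) @ \oo -->
  \sum_(z <- r) li (f z).
Proof. by move=> vf; apply: laurent_cvg_sum => z zr; apply: power_sum_cvg; exact: vf. Qed.

(** The bounds [D] and [D.+1] give the same limit, so no merged words appear for an empty prefix. *)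
Lemma li_relation e v : e != 0 -> all valid_letter v ->
  li ((q, e) :: v) + \sum_(z <- absorb (q, e) v) li z =
  carlitz_coef e *: \sum_(z <- stuffle1 (q.-1, 1) v) li ((1%N, e) :: z).
Proof.
move=> e0 vv; have vq := valid_card e0.
have vS z : z \in stuffle1 (q.-1, 1) v -> all valid_letter ((1%N, e) :: z).
  by move=> /(stuffle1_valid valid_card_pred vv) /= ->; rewrite andbT /valid_letter e0.
have vqv : all valid_letter ((q, e) :: v) by rewrite /= vq.
have lhs := laurent_cvgD (power_sum_cvg vqv)
  (li_sum_cvg (f := id) (fun z => absorb_valid vq vv)).
have rhs := laurent_cvgM (c := ratfun_laurent (carlitz_coef e)) (laurent_cvgS (li_sum_cvg vS)).
apply: laurent_cvg_eq lhs rhs _ => D /=.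
by rewrite -!rmorph_sum -rmorphD carlitz_relation_sum // rmorphM.
Qed.

Lemma li_relation_prefix u a e v : e != 0 ->
  all valid_letter u -> valid_letter a -> all valid_letter v ->
  li (u ++ a :: (q, e) :: v) + \sum_(z <- absorb (q, e) v) li (u ++ a :: z) =
  carlitz_coef e *: \sum_(z <- stuffle1 (q.-1, 1) v)
    (li (u ++ a :: (1%N, e) :: z) + li (u ++ letter_mul a (1%N, e) :: z)).
Proof.
move=> e0 vu va vv; have vq := valid_card e0.
have v1 : valid_letter (1%N, e) by rewrite /valid_letter e0.
have vS z : z \in stuffle1 (q.-1, 1) v -> all valid_letter z.
  exact: stuffle1_valid valid_card_pred vv.
have vqv : all valid_letter (u ++ a :: (q, e) :: v) by rewrite all_cat vu /= va vq.
have vA z : z \in absorb (q, e) v -> all valid_letter (u ++ a :: z).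
  by move=> zv; rewrite all_cat vu /= va (absorb_valid vq vv zv).
have vS1 z : z \in stuffle1 (q.-1, 1) v -> all valid_letter (u ++ a :: (1%N, e) :: z).
  by move=> /vS vz; rewrite all_cat vu /= va v1.
have vS2 z : z \in stuffle1 (q.-1, 1) v ->
    all valid_letter (u ++ letter_mul a (1%N, e) :: z).
  by move=> /vS vz; rewrite all_cat vu /= valid_letter_mul.
have lhs := laurent_cvgD (power_sum_cvg vqv) (li_sum_cvg vA).
have rhs := laurent_cvgM (c := ratfun_laurent (carlitz_coef e))
  (laurent_cvgD (li_sum_cvg vS1) (li_sum_cvg vS2)).
rewrite big_split; apply: laurent_cvg_eq lhs rhs _ => D /=.
rewrite -!rmorph_sum -!rmorphD carlitz_relation_prefix // rmorphM.
by rewrite big_split.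
Qed.

(** * The rank of a word and the words to be rewritten *)

Fixpoint lex_code (B : nat) w : nat :=
  if w is a :: v then (a.1 * B ^ size v + lex_code B v)%N else 0%N.

Lemma lex_code_cat B u w :
  lex_code B (u ++ w) = (lex_code B u * B ^ size w + lex_code B w)%N.
Proof.
by elim: u => [|a u IH] //=; rewrite IH size_cat expnD; ring.
Qed.

(** The exponents are digits in base [B], most significant first; a weight below [B] makes each of
    them a proper digit. *)
Lemma lex_code_lt B w : (weight w < B)%N -> (lex_code B w < B ^ size w)%N.
Proof.
elim: w => [|a w IH] //=; rewrite weight_cons => wB.
have wlt := IH (leq_ltn_trans (leq_addl _ _) wB).
apply: (@leq_trans (a.1.+1 * B ^ size w)); first by rewrite mulSn addnC ltn_add2r.
rewrite expnS leq_mul2r; apply/orP; right; lia.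
Qed.

Lemma lex_code_cat_lt B u a b v w : (weight v < B)%N -> (a.1 < b.1)%N -> size v = size w ->
  (lex_code B (u ++ a :: v) < lex_code B (u ++ b :: w))%N.
Proof.
move=> vB ab vw; rewrite !lex_code_cat /= vw ltn_add2l.
apply: (@leq_trans (a.1.+1 * B ^ size w)).
  by rewrite mulSn addnC ltn_add2r -vw lex_code_lt.
by apply: leq_trans (leq_addr _ _); rewrite leq_mul2r ab orbT.
Qed.

Lemma size_weight w : all valid_letter w -> (size w <= weight w)%N.
Proof.
elim: w => [|a w IH] //= /andP[/andP[a0 _] /IH wS]; rewrite weight_cons; lia.
Qed.

(* Orders words of weight n by length first, then lexicographically. *)
Definition rank (n : nat) w : nat := (size w * n.+1 ^ n + lex_code n.+1 w)%N.

(** Positive exponents keep the length at most [n], so the lexicographic code stays below the factor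
    [n.+1 ^ n] of the length. *)
Lemma rank_size n w x : all valid_letter w -> weight w = n -> (size w < size x)%N ->
  (rank n w < rank n x)%N.
Proof.
move=> vw wn wx; rewrite /rank; apply: leq_trans (leq_addr _ _).
apply: (@leq_trans ((size w).+1 * n.+1 ^ n)); last by rewrite leq_mul2r wx orbT.
rewrite mulSn addnC ltn_add2r; apply: leq_trans (lex_code_lt _) _; first by rewrite wn.
by apply: leq_pexp2l => //; rewrite -wn size_weight.
Qed.

(** Turns the growing rank into the decreasing measure [n.+1 ^ n.+1 - rank n w]. *)
Lemma rank_bound n w : all valid_letter w -> weight w = n -> (rank n w < n.+1 ^ n.+1)%N.
Proof.
move=> vw wn; rewrite expnS mulSn /rank.
have sw : (size w <= n)%N by rewrite -wn size_weight.
have lw : (lex_code n.+1 w < n.+1 ^ n)%N.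
  by apply: leq_trans (lex_code_lt _) _; [rewrite wn | exact: leq_pexp2l].
by rewrite -addnS addnC leq_add // leq_mul2r sw orbT.
Qed.

(** The boolean added to [q] is 1 except at the last letter, so the first alternative is the bound
    defining [AT]. An offending exponent exceeds [q], or equals [q] in last position. *)
Lemma word_cases w :
  (forall i, (i < size w)%N -> ((nth (0%N, 0%R) w i).1 < q + (i.+1 < size w))%N) \/
  exists u s e v, w = u ++ ((q + s)%N, e) :: v /\ ((0 < s)%N \/ s = 0%N /\ v = [::]).
Proof.
elim: w => [|a w [IH|[u [s [e [v [-> sv]]]]]]]; first by left.
- case: (ltnP a.1 (q + (0 < size w))) => aq.
    by left=> -[|i] //= /IH.
  right; exists [::], (a.1 - q)%N, a.2, w; rewrite subnKC -?surjective_pairing;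
    last exact: leq_trans (leq_addr _ _) aq.
  split=> //; case: w aq {IH} => [|b w] /= aq; last by left; rewrite subn_gt0 -addn1.
  by case: (posnP (a.1 - q)) => ?; [right | left].
by right; exists (a :: u), s, e, v.
Qed.

(** * Arrays of exponents and characters as words *)

Definition mkword n (eps : 'I_n -> F) (s : 'I_n -> nat) : word :=
  [seq (s i, eps i) | i <- enum 'I_n].

Lemma mkword_nth w :
  mkword (fun i : 'I_(size w) => (nth (0%N, 0%R) w i).2) (fun i => (nth (0%N, 0%R) w i).1) = w.
Proof.
rewrite /mkword; under eq_map do rewrite -surjective_pairing.
by rewrite (map_comp (nth _ w) val) val_enum_ord map_nth_iota0 ?take_size.
Qed.

Lemma mkword_valid n (eps : 'I_n -> F) (s : 'I_n -> nat) (k : nat) :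
  admissible eps s k <-> all valid_letter (mkword eps s) /\ weight (mkword eps s) = k.
Proof.
rewrite /mkword /weight big_map big_enum all_map; split.
  by move=> [e0 s0 ->]; split=> //; apply/allP => i _; rewrite /= /valid_letter s0 e0.
move=> [/allP vw ws]; split=> // i; by have /andP[] := vw i (mem_enum _ _).
Qed.

Lemma mkwordS n (eps : 'I_n.+1 -> F) (s : 'I_n.+1 -> nat) :
  mkword eps s = (s ord0, eps ord0) ::
    mkword (fun i => eps (lift ord0 i)) (fun i => s (lift ord0 i)).
Proof. by rewrite /mkword enum_ordSl /= -map_comp. Qed.

Lemma power_sumE a w D :
  power_sum (a :: w) D = \sum_(d < D) letter_term a d * power_sum w d.
Proof. by []. Qed.

Lemma decreasing_cons n D m (x : 'I_D) (d : {ffun 'I_n -> 'I_D}) :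
  let f := [ffun i => oapp d x (unlift ord0 i)] in
  decreasing f && [forall i, f i < m]%N =
  (x < m)%N && (decreasing d && [forall i, d i < x]%N).
Proof.
move=> f; have f0 : f ord0 = x by rewrite ffunE unlift_none.
have fS i : f (lift ord0 i) = d i by rewrite ffunE liftK.
apply/idP/idP.
  move=> /andP[/forallP df /forallP fm].
  have dx i : (d i < x)%N.
    by have /forallP/(_ (lift ord0 i)) := df ord0; rewrite f0 fS.
  rewrite -f0 fm /= f0; apply/andP; split; apply/forallP => // i; apply/forallP => j.
  apply/implyP => ij; have /forallP/(_ (lift ord0 j))/implyP := df (lift ord0 i).
  by rewrite !fS; apply.
move=> /and3P[xm /forallP dd /forallP dx]; apply/andP; split.
  apply/forallP => i; apply/forallP => j; apply/implyP.
  case: (unliftP ord0 i) => [i'|] ->; case: (unliftP ord0 j) => [j'|] -> //=.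
    by move=> ij; rewrite !fS; have /forallP/(_ j')/implyP := dd i'; apply.
  by rewrite f0 fS.
apply/forallP => i; case: (unliftP ord0 i) => [i'|] ->; rewrite ?fS ?f0 //.
exact: ltn_trans (dx i') xm.
Qed.

(** The index type ['I_D] stays fixed while [m] varies, so that the induction can lower the bound to
    the first index. *)
Lemma acmpl_term_sum n (eps : 'I_n -> F) (s : 'I_n -> nat) D m : (m <= D)%N ->
  \sum_(d : {ffun 'I_n -> 'I_D} | decreasing d && [forall i, d i < m]%N)
    acmpl_term eps s (fun i => d i) = power_sum (mkword eps s) m.
Proof.
elim: n eps s m => [|n IH] eps s m mD.
  have f0 (i : 'I_0) : 'I_D by case: i.
  rewrite (big_pred1 [ffun i => f0 i]) => [|d] /=.
    by rewrite /acmpl_term big_ord0 /mkword enum_ord0.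
  rewrite (_ : d == _); first by apply/andP; split; apply/forallP => -[].
  by apply/eqP/ffunP => -[].
rewrite mkwordS power_sumE (big_ord_widen_cond D xpredT
  (fun d => letter_term _ d * power_sum _ d)) //.
(* [h] and [g] are mutually inverse: they attach and split off the first index. *)
pose h (p : 'I_D * {ffun 'I_n -> 'I_D}) : {ffun 'I_n.+1 -> 'I_D} :=
  [ffun i => oapp p.2 p.1 (unlift ord0 i)].
pose g (f : {ffun 'I_n.+1 -> 'I_D}) := (f ord0, [ffun i => f (lift ord0 i)]).
have hK : cancel g h.
  by move=> f; apply/ffunP => i; rewrite ffunE; case: unliftP => [j|] -> //=; rewrite ffunE.
have gK : cancel h g.
  move=> [x d]; rewrite /g /h /= ffunE unlift_none; congr (_, _).
  by apply/ffunP => i; rewrite !ffunE liftK.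
rewrite (reindex h) /=; last by exists g => x _.
under eq_bigl do rewrite decreasing_cons.
rewrite -(pair_big_dep (fun x : 'I_D => (x < m)%N)
  (fun x d => decreasing d && [forall i, d i < x]%N)
  (fun x d => acmpl_term eps s (fun i => h (x, d) i))) /=.
apply: eq_bigr => x xm; rewrite -IH; last exact: ltnW.
rewrite mulr_sumr; apply: eq_bigr => d _.
rewrite /acmpl_term big_ord_recl /= ffunE unlift_none; congr (_ * _).
by apply: eq_bigr => i _; rewrite ffunE liftK.
Qed.

Lemma acmplE n (eps : 'I_n -> F) (s : 'I_n -> nat) : acmpl eps s = li (mkword eps s).
Proof.
rewrite /acmpl /li.
suff -> : (fun D => \sum_(d : {ffun 'I_n -> 'I_D} | decreasing d)
    ratfun_laurent (acmpl_term eps s (fun i => d i))) =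
  (fun D => ratfun_laurent (power_sum (mkword eps s) D)) by [].
apply/funext => D.
rewrite -(acmpl_term_sum eps s (leqnn D)) rmorph_sum; apply: eq_bigl => d.
by rewrite [X in _ && X](_ : _ = true) ?andbT //; apply/forallP.
Qed.

Lemma li_AT n w : all valid_letter w -> weight w = n ->
  (forall i, (i < size w)%N -> ((nth (0%N, 0%R) w i).1 < q + (i.+1 < size w))%N) ->
  AT F n (li w).
Proof.
move=> vw wn wq; pose eps (i : 'I_(size w)) := (nth (0%N, 0%R) w i).2.
pose s (i : 'I_(size w)) := (nth (0%N, 0%R) w i).1.
have wE : mkword eps s = w := mkword_nth w.
exists (size w), eps, s; split; last by rewrite acmplE wE.
- by apply/mkword_valid; rewrite wE.
- by move=> i iw; have := wq i (ltn_ord i); rewrite iw addn1.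
- by move=> i iw; have := wq i (ltn_ord i); rewrite iw ltnn addn0.
Qed.

(** * The rewriting step and its termination *)

Section Reduction.
Variables (A : set (laurent F)) (n r : nat).
Hypothesis above : forall x, all valid_letter x -> weight x = n -> (r < rank n x)%N ->
  lspan A (li x).

(** [u ++ y] is the word being rewritten: either [y] is [(q + s, e) :: v'] and [v] is
    [(s, 1) :: v'], or [y] is [[:: (q, e)]] and [v] is empty. The condition on sizes covers both
    cases. *)
Lemma lspan_relation u y e v : e != 0 -> all valid_letter u -> all valid_letter v ->
  (weight u + (q + weight v))%N = n -> weight (u ++ y) = n -> all valid_letter (u ++ y) ->
  size y = maxn 1 (size v) -> r = rank n (u ++ y) ->
  lspan A (li (u ++ (q, e) :: v) + \sum_(z <- absorb (q, e) v) li (u ++ z)).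
Proof.
move=> e0 vu vv wn wy vy sy rE; have q1 := card_gt1.
have v1 : valid_letter (1%N, e) by rewrite /valid_letter e0.
have vS z : z \in stuffle1 (q.-1, 1) v -> all valid_letter z.
  exact: stuffle1_valid valid_card_pred vv.
have sz z (zS : z \in stuffle1 (q.-1, 1) v) : (size y <= size z)%N.
  by rewrite sy; exact: stuffle1_size zS.
have wz z (zS : z \in stuffle1 (q.-1, 1) v) : weight z = (q + weight v).-1.
  by rewrite (stuffle1_weight zS) /=; move: (q) q1 => p p1; lia.
have deeper z : z \in stuffle1 (q.-1, 1) v -> lspan A (li (u ++ (1%N, e) :: z)).
  move=> zS; apply: above.
  - by rewrite all_cat vu /= v1 vS.
  - by rewrite weight_cat weight_cons (wz z zS) /=; move: (q) q1 wn => p p1 wn; lia.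
  - by rewrite rE; apply: rank_size => //; rewrite !size_cat /= ltn_add2l ltnS sz.
(* The last letter of a nonempty prefix is the one that merges with [(1, e)]. *)
case: (lastP u) vu wn wy vy rE deeper => [|u' a] vu wn wy vy rE deeper.
  by rewrite li_relation //; apply/lspanZ/lspan_sum_seq.
move: vu; rewrite all_rcons => /andP[va vu].
under eq_bigr do rewrite cat_rcons.
rewrite cat_rcons li_relation_prefix //.
apply/lspanZ/lspan_sum_seq => z zS; apply: lspanD.
  by rewrite -cat_rcons; exact: deeper.
apply: above.
- by rewrite all_cat vu /= valid_letter_mul // vS.
- move: wn; rewrite -cats1 !weight_cat !weight_cons (wz z zS) /= /weight big_nil.
  by move: (q) q1 => p p1; lia.
move: wy vy rE; rewrite cat_rcons => wy vy ->.
(* A merged word is longer, or equally long with the exponent of [a] raised by 1. *)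
have := sz z zS; rewrite leq_eqVlt => /predU1P[yz|yz]; last first.
  by apply: rank_size => //; rewrite !size_cat /= ltn_add2l ltnS.
rewrite /rank !size_cat /= yz ltn_add2l; apply: lex_code_cat_lt => //=.
  by rewrite ltnS -wy weight_cat weight_cons; lia.
by rewrite addn1.
Qed.

End Reduction.

Lemma li_lspan_AT n w : all valid_letter w -> weight w = n -> lspan (AT F n) (li w).
Proof.
have [k] := ubnP (n.+1 ^ n.+1 - rank n w); elim: k w => // k IH w wk vw wn.
have above x : all valid_letter x -> weight x = n -> (rank n w < rank n x)%N ->
    lspan (AT F n) (li x).
  by move=> vx xn wx; apply: IH => //; have := rank_bound vw wn; have := rank_bound vx xn; lia.
case: (word_cases w) => [good|[u [s [e [v [wE sv]]]]]].
  by apply/lspan_sub/li_AT.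
have rE : rank n w = rank n (u ++ ((q + s)%N, e) :: v) by rewrite wE.
have := vw; rewrite {1}wE all_cat /= => /and3P[vu /andP[_ /= e0] vv].
have := wn; rewrite {1}wE weight_cat weight_cons /= => wn'.
case: sv => [s0|[s0 v0]].
  have v1 : valid_letter (s, 1 : F) by rewrite /valid_letter s0 oner_neq0.
  have vv' : all valid_letter ((s, 1) :: v) by rewrite /= v1.
  (* With the tail [(s, 1) :: v] the absorbed word is [w] itself. The other word on the left has one
     letter more, so its value lies in the span and can be subtracted. *)
  have := @lspan_relation _ _ _ above u (((q + s)%N, e) :: v) e _ e0 vu vv'.
  rewrite -wE big_seq1 /letter_mul mulr1 -wE => /(_ _ wn vw _ erefl) H.
  have : lspan (AT F n) (li (u ++ (q, e) :: (s, 1) :: v)).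
    apply: above; first by rewrite all_cat vu /= valid_card // v1.
      by rewrite weight_cat !weight_cons -wn' /=; lia.
    by apply: rank_size => //; rewrite wE !size_cat /= ltn_add2l.
  move=> /(lspanB (H _ _)) {H}; rewrite addrAC subrr add0r; apply.
    by rewrite weight_cons -wn' /=; lia.
  by rewrite /=; lia.
move: wE wn'; rewrite s0 v0 addn0 => wE wn'.
(* An empty tail absorbs nothing, so [w] stands alone on the left. *)
have := @lspan_relation _ _ _ above u [:: (q, e)] e [::] e0 vu isT.
by rewrite -wE big_nil addr0; apply.
Qed.

End Words.

Theorem proposition1p10 (F : finFieldType) (w : nat) (hw : (0 < w)%N) :
  generates (AT F w) (AL F w).
Proof.
split=> [x [n [eps [s [adm _ _ xE]]]]|].
  by apply: lspan_sub; exists n, eps, s.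
apply/seteqP; split.
  apply: lspan_min => x [n [eps [s [adm _ _ xE]]]].
  by apply: lspan_sub; exists n, eps, s.
apply: lspan_min => _ [n [eps [s [/mkword_valid[vw ww] ->]]]].
by rewrite acmplE; exact: li_lspan_AT.
Qed.
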